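(* Let $G$ be a connected graph and let $T\subseteq V(G)$ be a set of vertices of even size. Then every minimum $T$-join $J$ of $G$ satisfies $|J|\le |E(G)|-\frac12|E(\widehat{G})|$.
   Context: Graphs are finite and may have multiple edges and loops (a loop is an edge and contributes 2 to the degree of its vertex). A $T$-join of $G$ is a set $J\subseteq E(G)$ such that, for every vertex $v$, the number $d_J(v)$ of edges of $J$ incident with $v$ (degree of $v$ in $J$) is odd if and only if $v\in T$. A $T$-join is minimum if it has the minimum number of edges among all $T$-joins of $G$. $\widehat{G}$ denotes the maximal bridgeless subgraph of $G$, i.e. the subgraph whose edges are exactly the edges of $G$ that are not bridges (cut-edges) of $G$. *)

(* Defs.v *)
From mathcomp Require Import all_boot all_order all_algebra.

Set Implicit Arguments.
Unset Strict Implicit.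
Unset Printing Implicit Defensive.

(* Finite multigraphs: [gsrc e] and [gtgt e] are the two ends of the edge [e],
   listed in an arbitrary order that no notion below depends on.  Distinct edges
   may have the same ends, and [e] is a loop when its two ends are equal. *)
Record mgraph := MGraph {
  gvertex : finType;
  gedge : finType;
  gsrc : gedge -> gvertex;
  gtgt : gedge -> gvertex
}.

Section Graph.
Variable G : mgraph.
Implicit Types (F J : {set gedge G}) (T : {set gvertex G}).

(* Adjacency in the spanning subgraph of G with edge set F. *)
Definition adj F : rel (gvertex G) := fun x y =>
  [exists e in F, ((gsrc e == x) && (gtgt e == y))
               || ((gsrc e == y) && (gtgt e == x))].

Definition gconnected : Prop :=
  forall x y : gvertex G, connect (adj [set: gedge G]) x y.

Definition ncomponents F : nat := n_comp (adj F) (gvertex G).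

Definition is_bridge (e : gedge G) : bool :=
  ncomponents [set: gedge G] < ncomponents [set~ e].

(* The edge set of the maximal bridgeless subgraph of G. *)
Definition bridgeless_edges : {set gedge G} := [set e | ~~ is_bridge e].

(* A loop contributes 2. *)
Definition degree_in J (v : gvertex G) : nat :=
  \sum_(e in J) ((gsrc e == v) + (gtgt e == v)).

Definition is_tjoin T J : Prop :=
  forall v : gvertex G, odd (degree_in J v) <-> v \in T.

Definition min_tjoin T J : Prop :=
  is_tjoin T J /\ forall J', is_tjoin T J' -> #|J| <= #|J'|.

End Graph.

(* Main.v *)
(** The symmetric difference of a T-join with an even edge set (one in which all
    degrees are even) is again a T-join, so a minimum T-join [J] is no larger
    than the average size of [J + C] over all even sets [C].  An edge [e] that
    is not a bridge lies in some even set [K], and the involution [C |-> C + K]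
    shows that [e] belongs to exactly half of the sets [J + C]; hence the average
    is at most [|E| - |bridgeless edges| / 2]. *)

Require Import Defs.
From mathcomp Require Import all_boot all_order all_algebra.
From mathcomp Require Import lra.
Import Order.TTheory GRing.Theory Num.Theory.
Local Open Scope ring_scope.

Set Implicit Arguments.
Unset Strict Implicit.
Unset Printing Implicit Defensive.

Section SymmetricDifference.
Local Open Scope nat_scope.
Variable E : finType.
Implicit Types A B C : {set E}.

Definition symdiff A B : {set E} := [set e | (e \in A) (+) (e \in B)].

Lemma in_symdiff A B e : (e \in symdiff A B) = (e \in A) (+) (e \in B).
Proof. by rewrite inE. Qed.

Lemma symdiffK B : involutive (symdiff^~ B).
Proof. by move=> A; apply/setP=> e; rewrite !in_symdiff addbK. Qed.

(** The involution [C |-> symdiff C B] maps [Z] to itself and, as [e \in B], toggles whether [e]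
    lies in [symdiff A C]. It therefore exchanges the selected members of [Z] with the remaining
    ones. *)
Lemma card_symdiff_half (Z : {set {set E}}) A B e :
  {in Z, forall C, symdiff C B \in Z} -> e \in B ->
  (#|[set C in Z | e \in symdiff A C]|).*2 = #|Z|.
Proof.
move=> ZB eB; set S := [set C in Z | _].
have SZ : S \subset Z by apply/subsetP=> C; rewrite inE => /andP[].
have im : symdiff^~ B @: S = Z :\: S.
  apply/setP=> C; apply/imsetP/idP=> [[D] | ].
    rewrite inE in_symdiff => /andP[DZ De] ->.
    by rewrite !inE ZB // eB; move: De; do 2 case: (_ \in _).
  rewrite !inE => /andP[Ce CZ].
  exists (symdiff C B); last by rewrite symdiffK.
  by rewrite !inE ZB // eB; move: Ce; rewrite CZ; do 2 case: (_ \in _).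
have := cardsID S Z; rewrite (setIidPr SZ) -im card_imset ?addnn //.
exact: inv_inj (symdiffK B).
Qed.

End SymmetricDifference.

Section EvenSets.
Local Open Scope nat_scope.
Variable G : mgraph.
Implicit Types (F J K : {set gedge G}) (T : {set gvertex G}).

(** Exclusive-or over all edges makes parity additive under symmetric difference; a loop contributes
    2, hence [false]. *)
Lemma odd_degree_in J v :
  odd (degree_in J v) =
  \big[addb/false]_e ((e \in J) && ((gsrc e == v) (+) (gtgt e == v))).
Proof.
rewrite /degree_in big_mkcond /= (big_morph _ oddD (erefl _)).
by apply: eq_bigr => e _; case: (e \in J); rewrite // oddD !oddb.
Qed.

Lemma odd_degree_symdiff J K v :
  odd (degree_in (symdiff J K) v) = odd (degree_in J v) (+) odd (degree_in K v).
Proof.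
rewrite !odd_degree_in -big_split /=; apply: eq_bigr => e _.
by rewrite in_symdiff andb_addl.
Qed.

Lemma odd_degree_set1 (e : gedge G) v :
  odd (degree_in [set e] v) = (gsrc e == v) (+) (gtgt e == v).
Proof. by rewrite /degree_in big_set1 oddD !oddb. Qed.

Definition even_sets : {set {set gedge G}} :=
  [set C : {set gedge G} | [forall v, ~~ odd (degree_in C v)]].

Lemma even_setsP C :
  reflect (forall v, odd (degree_in C v) = false) (C \in even_sets).
Proof.
by rewrite inE; apply: (iffP forallP) => H v; [apply/negbTE | rewrite H].
Qed.

Lemma even_sets_symdiff C K :
  C \in even_sets -> K \in even_sets -> symdiff C K \in even_sets.
Proof.
move=> /even_setsP HC /even_setsP HK; apply/even_setsP=> v.
by rewrite odd_degree_symdiff HC HK.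
Qed.

Lemma even_sets_gt0 : 0 < #|even_sets|.
Proof.
by apply/card_gt0P; exists set0; apply/even_setsP=> v; rewrite /degree_in big_set0.
Qed.

Lemma is_tjoin_symdiff T J C :
  is_tjoin T J -> C \in even_sets -> is_tjoin T (symdiff J C).
Proof. by move=> HJ /even_setsP HC v; rewrite odd_degree_symdiff HC addbF. Qed.

(** [K] collects the edges used an odd number of times by the walk. Symmetric difference is used
    instead of union because the walk may repeat edges. *)
Lemma path_odd_set F x p :
  path (adj F) x p ->
  exists2 K : {set gedge G}, K \subset F &
    forall v, odd (degree_in K v) = (x == v) (+) (last x p == v).
Proof.
elim: p x => [|y p IHp] x /=.
  exists set0; first exact: sub0set.
  by move=> v; rewrite /degree_in big_set0 addbb.
case/andP=> /exists_inP[e eF exy] /IHp[K KF HK].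
exists (symdiff K [set e]).
  apply/subsetP=> f; rewrite in_symdiff in_set1.
  by case: eqP => [-> | _] //; rewrite addbF => /(subsetP KF).
move=> v; rewrite odd_degree_symdiff odd_degree_set1 HK.
(* In either orientation of [e], the two contributions of the intermediate vertex [y] cancel. *)
by case/orP: exy => /andP[/eqP-> /eqP->];
  do 3 case: (_ == v).
Qed.

Lemma adj_connect_sym F : connect_sym (adj F).
Proof.
apply: sym_connect_sym => x y.
by apply: eq_existsb => e; rewrite orbC.
Qed.

Lemma nonbridge_connect (e : gedge G) :
  gconnected G -> ~~ is_bridge e -> connect (adj [set~ e]) (gsrc e) (gtgt e).
Proof.
move=> Gconn; rewrite -leqNgt => le_comp.
have le1 : ncomponents [set~ e] <= 1.
  (* Components are counted by their canonical roots, and connectedness makes any two roots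
     equal. *)
  apply: leq_trans le_comp _; apply/card_le1_eqP=> x y.
  rewrite !inE !andbT => /eqP rx /eqP ry.
  by rewrite -rx -ry; apply: (fingraph.rootP (adj_connect_sym _) (Gconn y x)).
apply/(fingraph.rootP (adj_connect_sym _)).
by move/card_le1_eqP: le1; apply;
  rewrite !inE ?andbT roots_root //; apply: adj_connect_sym.
Qed.

(** A walk avoiding [e] between the ends of [e] is closed up by [e] itself; since its edge set
    misses [e], the symmetric difference contains [e]. *)
Lemma nonbridge_even_set (e : gedge G) :
  gconnected G -> ~~ is_bridge e -> exists2 K, K \in even_sets & e \in K.
Proof.
move=> Gconn /(nonbridge_connect Gconn)/connectP[p pth lastp].
have [K /subsetP Ksub HK] := path_odd_set pth.
exists (symdiff K [set e]).
  apply/even_setsP=> v.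
  by rewrite odd_degree_symdiff odd_degree_set1 HK -lastp addbb.
rewrite in_symdiff set11; case: (boolP (e \in K)) => // /Ksub.
by rewrite !inE eqxx.
Qed.

(** The averaging is a double count of the pairs [(C, e)] with [C] even and [e] in [symdiff J C].
    Multiplying by [#|even_sets|] and doubling avoids division in [nat]. *)
Lemma min_tjoin_bound T J :
  gconnected G -> min_tjoin T J ->
  (#|J|).*2 + #|bridgeless_edges G| <= (#|gedge G|).*2.
Proof.
move=> Gconn [HJ Jmin]; rewrite -(leq_pmul2r even_sets_gt0) mulnDl -doubleMl.
pose cnt e := #|[set C in even_sets | e \in symdiff J C]|.
have sumE : \sum_(C in even_sets) #|symdiff J C| = \sum_e cnt e.
  under eq_bigr => C _ do rewrite -sum1_card big_mkcond /=.
  rewrite exchange_big; apply: eq_bigr => e _ /=.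
  rewrite -big_mkcondr /= sum1_card /cnt cardsE.
  by apply: eq_card => C.
have leJ : #|J| * #|even_sets| <= \sum_e cnt e.
  rewrite -sumE mulnC -sum_nat_const; apply: leq_sum => C HC.
  exact/Jmin/is_tjoin_symdiff.
(* For a bridge, the trivial bound [cnt e <= #|even_sets|] suffices; for any other edge, exactly
   half of the even sets are counted and equality holds. *)
have cnt_le e : (cnt e).*2 + (e \in bridgeless_edges G) * #|even_sets|
                <= (#|even_sets|).*2.
  rewrite inE; case: (boolP (is_bridge e)) => [_ | eb].
    rewrite mul0n addn0 leq_double; apply: subset_leq_card.
    by apply/subsetP=> C; rewrite inE => /andP[].
  have [K KZ eK] := nonbridge_even_set Gconn eb.
  rewrite mul1n (@card_symdiff_half _ _ _ K) ?addnn //.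
  by move=> C CZ; apply: even_sets_symdiff.
(* Summing over all edges and bounding the total of [cnt] below by [leJ] gives the claim. *)
have : \sum_e ((cnt e).*2 + (e \in bridgeless_edges G) * #|even_sets|)
       <= \sum_(e : gedge G) (#|even_sets|).*2 by apply: leq_sum.
have cardB : \sum_e (e \in bridgeless_edges G : nat) = #|bridgeless_edges G|.
  by rewrite -sum1_card [RHS]big_mkcond.
rewrite big_split /= -big_distrl /= cardB sum_nat_const.
rewrite -(big_morph _ doubleD double0) -doubleMr doubleMl; apply: leq_trans.
by rewrite leq_add2r leq_double.
Qed.

End EvenSets.

Theorem theorem2p2 (G : mgraph) (T : {set gvertex G}) (J : {set gedge G}) :
  gconnected G ->
  ~~ odd #|T| ->
  min_tjoin T J ->
  #|J|%:R <= #|gedge G|%:R - 2%:R^-1 * #|bridgeless_edges G|%:R :> rat.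
Proof.
move=> Gconn _ /(min_tjoin_bound Gconn).
rewrite -(ler_nat rat) natrD -!muln2 !natrM.
lra.
Qed.
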